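(* For any Tychonoff space $X$, the free locally convex space $L(X)$ contains no infinite-dimensional vector subspace which, with the induced topology, is a Fréchet locally convex space. Consequently, every Banach subspace of $L(X)$ has separable dual, but $L(X)$ is not a Gâteaux Differentiability Space provided $X$ is infinite.
   Context: All vector spaces are real; all topological vector spaces are Hausdorff; ''lcs'' means locally convex space. A Fréchet lcs is a metrizable and complete lcs. A lcs $E$ is a Gâteaux Differentiability Space (GDS) if every continuous convex function $f:D\to\mathbb{R}$, where $D\subset E$ is a nonempty open convex set, is Gâteaux differentiable on a dense subset of $D$. Here $f$ is Gâteaux differentiable at $x\in D$ if there is $x^*\in E'$ with $\lim_{t\to 0}\frac{f(x+ty)-f(x)}{t}=x^*(y)$ for every $y\in E$. For a Tychonoff space $X$, the free lcs $L(X)$ is a lcs together with a continuous map $i:X\to L(X)$ such that every continuous map $f$ from $X$ to a lcs $E$ gives rise to a unique continuous linear operator $\widehat f:L(X)\to E$ with $f=\widehat f\circ i$. It always exists and is unique; $i$ is a topological embedding and $i(X)$ is a Hamel basis of $L(X)$. *)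

(* Defs.v *)
From HB Require Import structures.
From mathcomp Require Import all_boot all_order all_algebra.
From mathcomp Require Import all_classical all_reals all_analysis.

Set Implicit Arguments.
Unset Strict Implicit.
Unset Printing Implicit Defensive.

Import Order.TTheory GRing.Theory Num.Theory.
Import numFieldNormedType.Exports.

Local Open Scope classical_set_scope.
Local Open Scope ring_scope.

Definition tychonoff_space (X : topologicalType) : Prop :=
  completely_regular_space X /\ hausdorff_space X.

Section Lcs.
Context {R : realType}.

(* [tvsType R] is locally convex but not necessarily Hausdorff, hence the
   explicit separation hypotheses. *)
Definition free_lcs (X : topologicalType) (L : tvsType R) (i : X -> L) : Prop :=
  [/\ hausdorff_space L, continuous i &
      forall E : tvsType R, hausdorff_space E ->
      forall f : X -> E, continuous f ->
      exists! g : L -> E, [/\ linear g, continuous g & f = g \o i]].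

Definition infinite_dimensional (E : lmodType R) : Prop :=
  ~ exists (n : nat) (b : 'I_n -> E),
      forall x : E, exists c : 'I_n -> R, x = \sum_(k < n) c k *: b k.

Definition metrizable (T : topologicalType) : Prop :=
  exists d : T -> T -> R,
    [/\ forall x y, d x y = 0 <-> x = y,
        forall x y, d x y = d y x,
        forall x y z, d x z <= d x y + d y z &
        forall (x : T) (U : set T),
          nbhs x U <-> exists2 e : R, 0 < e & [set y | d x y < e] `<=` U].

(* Cauchy filters are taken with respect to the translation-invariant
   uniformity determined by the topology: the entourages carried by a [tvsType]
   induce its topology but are not required to be translation invariant. *)
Definition tvs_cauchy (E : tvsType R) (F : set_system E) : Prop :=
  forall U : set E, nbhs 0 U ->
    exists2 A : set E, F A & forall x y, A x -> A y -> U (x - y).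

Definition tvs_complete (E : tvsType R) : Prop :=
  forall F : set_system E, ProperFilter F -> tvs_cauchy F ->
    exists x : E, F --> x.

Definition frechet (E : tvsType R) : Prop :=
  [/\ hausdorff_space E, metrizable E & tvs_complete E].

Definition is_norm (E : lmodType R) (N : E -> R) : Prop :=
  [/\ forall x, N x = 0 -> x = 0,
      forall a x, N (a *: x) = `|a| * N x &
      forall x y, N (x + y) <= N x + N y].

Definition norm_induces_topology (E : tvsType R) (N : E -> R) : Prop :=
  forall (x : E) (U : set E),
    nbhs x U <-> exists2 e : R, 0 < e & [set y | N (x - y) < e] `<=` U.

Definition banach_norm (E : tvsType R) (N : E -> R) : Prop :=
  [/\ is_norm N, norm_induces_topology N & tvs_complete E].

Definition continuous_dual (E : tvsType R) : set (E -> R^o) :=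
  [set phi | linear phi /\ continuous phi].
Arguments continuous_dual : clear implicits.

Definition dual_norm (E : lmodType R) (N : E -> R) (phi : E -> R^o) : R :=
  sup [set `|phi x| | x in [set x | N x <= 1]].

Definition separable_dual (E : tvsType R) (N : E -> R) : Prop :=
  exists A : set (E -> R^o),
    [/\ countable A, A `<=` continuous_dual E &
        forall phi, continuous_dual E phi -> forall e : R, 0 < e ->
          exists2 psi, A psi & dual_norm N (fun x => phi x - psi x) < e].

Definition gateaux_differentiable (E : tvsType R) (f : E -> R^o) (x : E) :
    Prop :=
  exists2 phi : E -> R^o, continuous_dual E phi &
    forall y : E, (f (x + t *: y) - f x) / t @[t --> 0^'] --> phi y.

(* A function on [D] is represented by a function on [E] whose values outside
   [D] are irrelevant. *)
Definition gateaux_differentiability_space (E : tvsType R) : Prop :=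
  forall (D : set E) (f : E -> R^o),
    D !=set0 -> open D -> convex_set D ->
    {within D, continuous f} -> convex_function D f ->
    D `<=` closure (D `&` [set x | gateaux_differentiable f x]).

End Lcs.

Section SubLcs.
Context {R : realType} {L : tvsType R} (V : submodClosed L).

Definition sub_lcs : Type := {x : L | x \in V}.

HB.instance Definition _ := SubChoice.on sub_lcs.
HB.instance Definition _ := [SubChoice_isSubLmodule of sub_lcs by <:].
HB.instance Definition _ :=
  Topological.copy sub_lcs (initial_topology (val : sub_lcs -> L)).

Lemma val_sub_lcs_continuous : continuous (val : sub_lcs -> L).
Proof. exact: initial_continuous. Qed.

Lemma continuous_to_sub_lcs (T : topologicalType) (f : T -> sub_lcs) :
  continuous (val \o f) -> continuous f.
Proof.
move=> cf x U [_ [[W oW <-] /= Wfx] WU].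
have nW : nbhs (val (f x)) W by exact: open_nbhs_nbhs.
have := cf x _ nW; rewrite /= !nbhs_simpl /=.
by apply: filterS => y Wy; exact: WU.
Qed.

Let sub_add_continuous : continuous (fun x : sub_lcs * sub_lcs => x.1 + x.2).
Proof.
apply: continuous_to_sub_lcs => -[x y].
apply: (@continuous_comp _ (L * L)%type _
  (fun z : sub_lcs * sub_lcs => (val z.1, val z.2)) (fun z => z.1 + z.2)).
  apply: cvg_pair.
    by apply: (@continuous_comp _ sub_lcs L fst val); [exact: cvg_fst|
      exact: val_sub_lcs_continuous].
  by apply: (@continuous_comp _ sub_lcs L snd val); [exact: cvg_snd|
    exact: val_sub_lcs_continuous].
exact: add_continuous.
Qed.

Let sub_scale_continuous : continuous (fun z : R^o * sub_lcs => z.1 *: z.2).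
Proof.
apply: continuous_to_sub_lcs => -[a x].
apply: (@continuous_comp _ (R^o * L)%type _
  (fun z : R^o * sub_lcs => (z.1, val z.2)) (fun z => z.1 *: z.2)).
  apply: (@cvg_pair _ _ _ _ (nbhs (a : R^o))); first exact: cvg_fst.
  by apply: (@continuous_comp _ sub_lcs L snd val); [exact: cvg_snd|
    exact: val_sub_lcs_continuous].
exact: scale_continuous.
Qed.

Let sub_locally_convex : exists2 B : set_system sub_lcs,
  (forall b, b \in B -> convex_set b) & basis B.
Proof.
have [B Bconv [Bo Bb]] := @locally_convex R L.
exists [set (val : sub_lcs -> L) @^-1` b | b in B].
  move=> _ /set_mem[b Bb' <-] x y t /set_mem/= xb /set_mem/= yb.
  apply/mem_set => /=.
  by apply/set_mem/(Bconv b); [exact/mem_set|exact/mem_set|exact/mem_set].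
split; first by move=> _ [b Bb' <-]; exists b => //; exact: Bo.
move=> x U [_ [[W oW <-] /= Wx] WU].
have [b [Bb' bx] bW] := Bb (val x) W (open_nbhs_nbhs (conj oW Wx)).
exists (val @^-1` b); first by split => //; exists b.
by move=> y /bW Wy; exact: WU.
Qed.

(* This factory equips [sub_lcs] with the translation-invariant uniformity of
   the induced topology; it does not register the remaining structures. *)
HB.instance Definition _ := PreTopologicalLmod_isTvs.Build R sub_lcs
  sub_add_continuous sub_scale_continuous sub_locally_convex.
HB.instance Definition _ := PreTopologicalNmodule_isTopologicalNmodule.Build
  sub_lcs sub_add_continuous.
HB.instance Definition _ := TopologicalNmodule_isTopologicalLmodule.Build
  R sub_lcs sub_scale_continuous.
HB.instance Definition _ := Uniform_isTvs.Build R sub_lcs sub_locally_convex.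

End SubLcs.

(* Main.v *)
(* By its universal property, L(X) is spanned by i(X), so its elements have finite
   supports; as X is Tychonoff, having at least n support points is an open
   condition.  If a subspace V is completely metrizable, Baire's theorem gives a
   nonempty open subset of V, hence all of V, where the supports have at most n
   points.  If v in V has a support of maximal size, a generic combination v + t w
   shows that every w in V is supported in supp v, so V is finite-dimensional, and
   then its dual is separable.

   If X is infinite, choose pairwise disjoint nonempty open sets U_n and bumps f_n
   supported in U_n with f_n(x_n) = 1.  The map x |-> (f_n(x) / (n + 1))_n is
   continuous into the finitely supported sequences with the l^1 norm, so
   mu |-> sum_n |mu(f_n)| / (n + 1) is a continuous seminorm on L(X).  Given mu,
   mu(f_n) = 0 for n large, and the seminorm is not differentiable at mu in the
   direction of i(x_n): it is nowhere Gateaux differentiable. *)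

Require Import Defs.
From HB Require Import structures.
From mathcomp Require Import all_boot all_order all_algebra.
From mathcomp Require Import all_classical all_reals all_analysis.

Set Implicit Arguments.
Unset Strict Implicit.
Unset Printing Implicit Defensive.

Import Order.TTheory GRing.Theory Num.Theory.
Import numFieldNormedType.Exports.

Local Open Scope classical_set_scope.
Local Open Scope ring_scope.

(** * Bundled linear maps and bump functions *)

Lemma linear_bundle (R : pzRingType) (U V : lmodType R) (g : U -> V) :
  linear g -> exists h : {linear U -> V}, g = h.
Proof.
by move=> lg; exists (HB.pack_for {linear U -> V} g
  (GRing.isLinear.Build R U V *:%R g lg)).
Qed.

Lemma completely_regular_bump (R : realType) (T : topologicalType) (x : T)
    (U : set T) :
  completely_regular_space T -> open U -> U x ->
  exists f : T -> R^o,
    [/\ continuous f, f x = 1, forall y, 0 <= f y <= 1 &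
        forall y, ~ U y -> f y = 0].
Proof.
move=> crT oU Ux.
have /(@uniform_separatorP _ R)[f [cf f01 fx f1]] :
  uniform_separator [set x] (~` U).
  by apply: crT; [exact: open_closedC|exact].
(* The separator is 0 at [x] and 1 off [U], so it is flipped. *)
exists (fun y => 1 - f y); split.
- move=> y; apply: cvgB; [exact: cvg_cst|exact: cf].
- by rewrite (fx (f x)) ?subr0//; exists x.
- move=> y; have : range f (f y) by exists y.
  by move=> /f01/=; rewrite in_itv/= => /andP[f0 fy1]; rewrite subr_ge0 fy1 gerBl.
- by move=> y nUy; rewrite (f1 (f y)) ?subrr//; exists y.
Qed.

(** * The Baire property *)

Lemma nbhs0_sub_nbhs (R : realType) (E : tvsType R) (N : set E) :
  nbhs 0 N -> exists2 V, nbhs 0 V & forall x y, V x -> V y -> N (x - y).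
Proof.
move=> N0; have := @sub_continuous E (0, 0) N; rewrite /= subrr => /(_ N0).
move=> [[A B] /= [A0 B0] AB]; exists (A `&` B); first exact: filterI.
by move=> x y [Ax _] [_ By]; exact: (AB (x, y)).
Qed.

Lemma nbhs_translate (R : realType) (E : tvsType R) (x : E) (N : set E) :
  nbhs x N -> nbhs 0 [set z | N (x + z)].
Proof.
move=> Nx; have := @add_continuous E (x, 0) N; rewrite /= addr0 => /(_ Nx).
move=> [[A B] /= [Ax B0] AB]; apply: filterS B0 => z Bz.
by apply: (AB (x, z)); split => //; exact: nbhs_singleton.
Qed.

Lemma nbhs_untranslate (R : realType) (E : tvsType R) (x : E) (N : set E) :
  nbhs 0 N -> nbhs x [set z | N (z - x)].
Proof.
move=> N0; have := @sub_continuous E (x, x) N; rewrite /= subrr => /(_ N0).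
move=> [[A B] /= [Ax Bx] AB]; apply: filterS Ax => z Az.
by apply: (AB (z, x)); split => //; exact: nbhs_singleton.
Qed.

(** Baire's nested-set argument. The metric need not be translation invariant, while [tvs_cauchy]
    is; so smallness of a set means that its differences lie in [D n], a ball about 0, and these
    balls form a base of neighbourhoods of 0. *)
Lemma tvs_baire (R : realType) (E : tvsType R) (F : nat -> set E) :
  @metrizable R E -> tvs_complete E -> (forall n, closed (F n)) ->
  (forall x, exists n, F n x) -> exists n (x : E), nbhs x (F n).
Proof.
move=> [d [d0 _ _ dnbhs]] cplE clF covF; apply: contrapT => noint.
pose D n := [set y : E | d 0 y < harmonic n].
have nD n : nbhs 0 (D n).
  by apply/dnbhs; exists (harmonic n); rewrite ?harmonic_gt0.
have step (nW : nat * set E) : exists W' : set E, (exists x : E, nbhs x nW.2) ->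
    [/\ exists x : E, nbhs x W', W' `<=` nW.2,
        forall x y, W' x -> W' y -> D nW.1 (x - y) &
        closure W' `<=` ~` F nW.1].
  case: nW => n W /=.
  have [[x Wx]|nW] := pselect (exists x : E, nbhs x W); last first.
    by exists set0 => /nW.
  have [y [Wy nFy]] : (W° `\` F n) !=set0.
    apply: contrapT => WF; apply: noint; exists n, x.
    apply: filterS (nbhs_interior Wx) => z Wz; apply: contrapT => nFz; apply: WF.
    by exists z.
  have Ny : nbhs y (W `\` F n).
    apply: filterI => //; apply: open_nbhs_nbhs; split => //.
    exact: closed_openC.
  (* The new set is [y + V]. If [z] is in its closure, some [u] has both [u - y] and [u - z] in [V];
     then [z - y] is in [V - V], which places [z] in [W] and outside [F n]. *)
  have [V V0 VV] := nbhs0_sub_nbhs (filterI (nbhs_translate Ny) (nD n)).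
  have V00 := nbhs_singleton V0.
  exists [set z | V (z - y)] => _; split.
  - by exists y; exact: nbhs_untranslate.
  - by move=> z /= /VV /(_ V00)[[]]; rewrite subr0 addrC subrK.
  - move=> u v /= Vu Vv; have [_] := VV _ _ Vu Vv.
    by rewrite opprB addrA subrK.
  - move=> z clz Fz; have [u [/= Vu Vuz]] := clz _ (nbhs_untranslate z V0).
    have [[_ +] _] := VV _ _ Vu Vuz.
    by rewrite /= opprB addrA [y + _]addrC subrK addrC subrK.
have [g gP] := choice step.
pose W := fix W n := if n is m.+1 then g (m, W m) else [set: E].
have nW n : exists x : E, nbhs x (W n).
  elim: n => [|n IH]; first by exists 0; exact: filterT.
  by have [] := gP (n, W n) IH.
have Wle m n : (m <= n)%N -> W n `<=` W m.
  elim: n => [|n IH]; first by rewrite leqn0 => /eqP ->.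
  rewrite leq_eqVlt => /predU1P[-> //|/IH sub] z zW; apply: sub.
  by have [_ + _ _] := gP (n, W n) (nW n); apply.
pose G := filter_from [set: nat] W.
have pG : ProperFilter G.
  apply: filter_from_proper.
    apply: filter_from_filter; first by exists 0%N.
    move=> m n _ _; exists (maxn m n) => // z Wz.
    by split; apply: Wle Wz; rewrite ?leq_maxl ?leq_maxr.
  by move=> n _; have [x Wx] := nW n; exists x; exact: nbhs_singleton.
have cG : tvs_cauchy G.
  move=> U /dnbhs [e e0 eU].
  have /cvgrPdist_lt/(_ _ e0)[m _ me] := @cvg_harmonic R.
  exists (W m.+1); first by exists m.+1.
  move=> x y Wx Wy; apply: eU => /=.
  have [_ _ /(_ _ _ Wx Wy) + _] := gP (m, W m) (nW m).
  move=> /lt_trans; apply.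
  by have := me m (leqnn m); rewrite /= sub0r normrN ger0_norm// harmonic_ge0.
have [x Gx] := cplE G pG cG.
have [n Fnx] := covF x.
(* The limit [x] lies in the closure of [W n.+1], which misses [F n]. *)
have [_ _ _ /(_ x)] := gP (n, W n) (nW n); apply => // U Ux.
have GU : G U by exact: Gx.
have GW : G (W n.+1) by exists n.+1.
by have [z [Uz Wz]] := filter_ex (filterI GU GW); exists z.
Qed.

(** * Supports in the free locally convex space *)

Lemma free_lcs_extend (R : realType) (X : topologicalType) (L : tvsType R)
    (i : X -> L) (f : X -> R^o) :
  free_lcs i -> continuous f ->
  exists h : {linear L -> R^o}, continuous h /\ forall x, h (i x) = f x.
Proof.
move=> [_ _ freeL] cf.
have [g [[lg cg Fg] _]] := freeL R^o (@Rhausdorff R) f cf.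
have [h gh] := linear_bundle lg; subst g.
by exists h; split => // x; rewrite Fg.
Qed.

(* [c] vanishes outside [s], so that [s] is exactly the support of [y]. *)
Definition supported (R : realType) (X : choiceType) (L : lmodType R)
    (i : X -> L) (y : L) (s : seq X) (c : X -> R) :=
  [/\ uniq s, forall x, (x \in s) = (c x != 0) & y = \sum_(x <- s) c x *: i x].

Section Supported.
Context (R : realType) (X : choiceType) (L : lmodType R) (i : X -> L).

Lemma supported_widen y s c u : supported i y s c -> uniq u ->
  {subset s <= u} -> y = \sum_(x <- u) c x *: i x.
Proof.
move=> [us sc ->] uu su.
rewrite [RHS](bigID (mem s)) /= [X in _ + X]big1 ?addr0.
  rewrite -[RHS]big_filter; apply: perm_big; apply: uniq_perm => //.
    exact: filter_uniq.
  by move=> x; rewrite mem_filter /=; have [/su|] := boolP (x \in s).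
by move=> x; rewrite sc negbK => /eqP ->; rewrite scale0r.
Qed.

(** Repeated points are merged: [c x] collects all coefficients attached to [x], and points where
    they cancel are dropped. *)
Lemma supported_of_sum (r : seq (R * X)) :
  exists s c, supported i (\sum_(p <- r) p.1 *: i p.2) s c.
Proof.
pose c x := \sum_(p <- r | p.2 == x) p.1.
pose u := undup [seq p.2 | p <- r].
exists [seq x <- u | c x != 0], c; split.
- by rewrite filter_uniq// undup_uniq.
- move=> x; rewrite mem_filter andb_idr// => cx.
  rewrite mem_undup; apply: contraR cx => xr.
  rewrite /c big_seq_cond big1// => p /andP[pr /eqP px].
  by rewrite -px map_f in xr.
- rewrite big_filter [RHS]big_mkcond /=.
  transitivity (\sum_(x <- u) c x *: i x); last first.
    by apply: eq_bigr => x _; case: eqVneq => // ->; rewrite scale0r.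
  rewrite /c; under [RHS]eq_bigr do rewrite scaler_suml.
  rewrite (exchange_big_dep predT)//= big_seq [RHS]big_seq.
  apply: eq_bigr => p pr.
  rewrite -big_filter (_ : [seq x <- u | p.2 == x] = [:: p.2]) ?big_seq1//.
  rewrite -(@filter_pred1_uniq _ u p.2) ?undup_uniq ?mem_undup ?map_f//.
  by apply: eq_filter => x; rewrite /= eq_sym.
Qed.

End Supported.

(** Uniqueness in the universal property forces [i] to span: the corestriction of [i] to its span
    [V] extends to [g : L -> V], and the inclusion composed with [g] is the identity because both
    extend [i]. *)
Lemma free_lcs_supported (R : realType) (X : topologicalType) (L : tvsType R)
    (i : X -> L) :
  free_lcs i -> forall y, exists s c, supported i y s c.
Proof.
move=> [hL ci freeL].
pose span : {pred L} := fun y =>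
  `[< exists r : seq (R * X), y = \sum_(p <- r) p.1 *: i p.2 >].
have span_closed : subsemimod_closed span.
  split; [split|].
  - by apply/asboolP; exists [::]; rewrite big_nil.
  - move=> u v /asboolP[r ->] /asboolP[r' ->]; apply/asboolP.
    by exists (r ++ r'); rewrite big_cat.
  - move=> a u /asboolP[r ->]; apply/asboolP.
    exists [seq (a * p.1, p.2) | p <- r]; rewrite big_map /= scaler_sumr.
    by apply: eq_bigr => p _; rewrite scalerA.
pose V : submodClosed L := HB.pack_for (submodClosed L) span
  (GRing.isSubmodClosed.Build R L span span_closed).
have iV x : i x \in V.
  by apply/asboolP; exists [:: (1, x)]; rewrite big_seq1 scale1r.
pose j x : sub_lcs V := exist _ (i x) (iV x).
have cj : continuous j by exact: continuous_to_sub_lcs.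
have hV : hausdorff_space (sub_lcs V).
  rewrite open_hausdorff => u v uv.
  have {}uv : val u != val v by rewrite (inj_eq val_inj).
  move: hL; rewrite open_hausdorff => /(_ _ _ uv).
  move=> [[A B] /= [uA vB]] [oA oB /eqP AB].
  exists (val @^-1` A, val @^-1` B) => /=.
    by split; apply/mem_set; exact: set_mem.
  split.
  - by apply: open_comp => // z _; exact: val_sub_lcs_continuous.
  - by apply: open_comp => // z _; exact: val_sub_lcs_continuous.
  - by rewrite -preimage_setI AB preimage_set0.
have [g [[lg cg jg] _]] := freeL (sub_lcs V) hV j cj.
have [h [_ hu]] := freeL L hL i ci.
have gE : val \o g = id.
  rewrite -[LHS]hu; last first.
    split.
    - by move=> a u v; rewrite /= lg.
    - by move=> u; apply: continuous_comp; [exact: cg|exact: val_sub_lcs_continuous].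
    - by apply/funext => x; rewrite [RHS]/= -[g (i x)]/((g \o i) x) -jg.
  apply: hu; split => //.
  by move=> u; exact: cvg_id.
move=> y; have /asboolP[r yr] : y \in V.
  by rewrite -[y]/(id y) -gE; exact: (valP (g y)).
have [s [c sc]] := supported_of_sum i r.
by exists s, c; rewrite yr.
Qed.

(** Small nonzero [t] avoids cancellation, so that [v + t w] can carry the union of the supports of
    [v] and [w]. *)
Lemma near_affine_neq0 (R : realType) (a b : R) : (a != 0) || (b != 0) ->
  \forall t \near (0 : R)^', a + t * b != 0.
Proof.
have [-> /= b0|a0 _] := eqVneq a 0.
  near=> t; rewrite add0r mulf_neq0//; near: t; exact: nbhs_dnbhs_neq.
have : (a + t * b) @[t --> (0 : R)^'] --> a.
  rewrite -[X in _ --> X]addr0 -[X in _ --> _ + X](mul0r b).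
  apply: cvgD; first exact: cvg_cst.
  by apply: cvgM; [exact: nbhs_dnbhs|exact: cvg_cst].
move=> /(_ [set z | z != 0]); apply.
by apply: open_nbhs_nbhs; split => //; exact: open_neq.
Unshelve. all: by end_near.
Qed.

Lemma open_bigcap_seq (T : topologicalType) (I : choiceType) (r : seq I)
    (W : I -> set T) :
  (forall y, y \in r -> open (W y)) -> open (\bigcap_(y in [set` r]) W y).
Proof.
move=> oW; rewrite bigcap_seq big_seq.
by elim/big_ind: _ => //; [exact: openT|exact: openI].
Qed.

Lemma hausdorff_separate_seq (T : topologicalType) (s : seq T) :
  hausdorff_space T ->
  exists U : T -> set T, [/\ forall x, open (U x), forall x, U x x &
    forall x y z, x \in s -> y \in s -> U x z -> U y z -> x = y].
Proof.
move=> hT.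
have sep (p : T * T) : exists AB : set T * set T, p.1 != p.2 ->
    [/\ open AB.1, open AB.2, AB.1 p.1, AB.2 p.2 & AB.1 `&` AB.2 = set0].
  have [->|pp] := eqVneq p.1 p.2; first by exists (set0, set0).
  move: hT; rewrite open_hausdorff => /(_ _ _ pp).
  move=> [[A B] /= [pA pB]] [oA oB /eqP AB].
  by exists (A, B) => _; split => //; exact: set_mem.
have [g gP] := choice sep.
(* The choices [g (x, y)] and [g (y, x)] are unrelated, so both are used: from [g (x, y)], [U x]
   takes the first set and [U y] the second. *)
pose U x := \bigcap_(y in [set` [seq y <- s | x != y]])
  ((g (x, y)).1 `&` (g (y, x)).2).
exists U; split.
- move=> x; apply: open_bigcap_seq => y; rewrite mem_filter => /andP[xy _].
  have [oA _ _ _ _] := gP (x, y) xy.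
  have /gP[_ oB _ _ _] : (y, x).1 != (y, x).2 by rewrite eq_sym.
  exact: openI.
- move=> x y /=; rewrite mem_filter => /andP[xy _].
  have [_ _ Ax _ _] := gP (x, y) xy.
  have /gP[_ _ _ Bx _] : (y, x).1 != (y, x).2 by rewrite eq_sym.
  by [].
- move=> x y z xs ys Uxz Uyz; apply/eqP/negPn/negP => xy.
  have [_ _ _ _ AB] := gP (x, y) xy.
  have : ((g (x, y)).1 `&` (g (x, y)).2) z.
    split.
      by have [] := Uxz y; rewrite //= mem_filter xy.
    by have [] := Uyz x; rewrite //= mem_filter eq_sym xy.
  by rewrite AB.
Qed.

Section FreeLcs.
Context (R : realType) (X : topologicalType) (L : tvsType R) (i : X -> L).
Context (tychonoffX : tychonoff_space X) (freeL : free_lcs i).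

(** Bumps around the points of [s] inside disjoint neighbourhoods, extended to [L]. On [s] they form
    a system dual to [i], so they read off coefficients. *)
Lemma separating_functionals (s : seq X) :
  exists h : X -> {linear L -> R^o}, [/\ forall x, continuous (h x),
    forall x, h x (i x) = 1 &
    forall x y z, x \in s -> y \in s -> h x (i z) != 0 -> h y (i z) != 0 -> x = y].
Proof.
have [crX hX] := tychonoffX.
have [U [oU Ux Udisj]] := hausdorff_separate_seq s hX.
have bump x : exists h : {linear L -> R^o}, [/\ continuous h, h (i x) = 1 &
    forall z, h (i z) != 0 -> U x z].
  have [f [cf fx _ fU]] := completely_regular_bump R crX (oU x) (Ux x).
  have [h [ch hi]] := free_lcs_extend freeL cf.
  exists h; split => //; first by rewrite hi.
  move=> z; rewrite hi => fz; apply: contrapT => /fU/eqP; exact/negP.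
have [h hP] := choice bump.
exists h; split.
- by move=> x; have [] := hP x.
- by move=> x; have [] := hP x.
- move=> x y z xs ys; have [_ _ hx] := hP x; have [_ _ hy] := hP y.
  by move=> /hx + /hy; exact: Udisj.
Qed.

(* Unlike "the support of [y] has at least [n] points", to which it is equivalent,
   this condition is visibly open in [y]. *)
Definition disjoint_detected n (y : L) :=
  exists h : 'I_n -> {linear L -> R^o}, [/\ forall j, continuous (h j),
    forall j k x, h j (i x) != 0 -> h k (i x) != 0 -> j = k &
    forall j, h j y != 0].

Lemma open_disjoint_detected n : open [set y | disjoint_detected n y].
Proof.
rewrite openE => y [h [ch hdisj hy]].
have : \forall z \near y, forall j, h j z != 0.
  apply: (@filter_forall _ 'I_n (fun j z => h j z != 0)) => j.
  apply: (ch j y [set z : R^o | z != 0]).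
  apply: open_nbhs_nbhs; split; [exact: (@open_neq R^o 0)|exact: hy].
by apply: filterS => z hz; exists h.
Qed.

(** The separating functional at a point [x] of [s] takes the value [c x] at [y], which is
    nonzero. *)
Lemma supported_detected y s c : supported i y s c -> disjoint_detected (size s) y.
Proof.
move=> [us sc yE].
have [h [ch hx hdisj]] := separating_functionals s.
have hiE x z : x \in s -> z \in s -> h x (i z) = (x == z)%:R.
  move=> xs zs; have [->|xz] := eqVneq x z; first by rewrite hx.
  apply/eqP/negPn/negP => hxz; move: xz; rewrite (hdisj x z z) ?eqxx// hx.
  exact: oner_neq0.
exists (fun j => h (tnth (in_tuple s) j)); split.
- by move=> j; exact: ch.
- move=> j k x hj hk; apply: (tuple_uniqP (in_tuple s) us).
  by apply: hdisj hj hk; exact: mem_tnth.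
- move=> j; set x := tnth _ _; have xs : x \in s by exact: mem_tnth.
  rewrite yE linear_sum /= (bigD1_seq x)//= linearZ /= hx big_seq_cond big1.
    by rewrite addr0 -[_ *: _]/(_ * _) mulr1 -sc.
  move=> z /andP[zs zx]; rewrite linearZ /= hiE// eq_sym (negbTE zx).
  by rewrite scaler0.
Qed.

(** Pigeonhole: each functional is nonzero at some [i x] with [x] in the support, and disjointness
    makes these points distinct. *)
Lemma detected_support_size n y s c : supported i y s c ->
  disjoint_detected n y -> (n <= size s)%N.
Proof.
move=> [us sc yE] [h [ch hdisj hy]].
have pt j : exists x, x \in s /\ h j (i x) != 0.
  apply: contrapT => nx; move/negP: (hy j); apply.
  rewrite yE linear_sum big_seq big1// => x xs; rewrite linearZ /=.
  have [->|hx] := eqVneq (h j (i x)) 0; first by rewrite scaler0.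
  by exfalso; apply: nx; exists x.
have [x xP] := choice pt.
have inj_x : injective x.
  move=> j k jk; have [_ hj] := xP j; have [_ hk] := xP k.
  by rewrite -jk in hk; exact: hdisj hj hk.
rewrite -[n]card_ord -(size_codom x) uniq_leq_size//; first exact/injectiveP.
by move=> _ /codomP[j ->]; case: (xP j).
Qed.

End FreeLcs.

(** * Finite-dimensionality *)

(** Among finite families in [P], one of maximal rank is taken; adjoining a further [u] in [P]
    cannot raise the rank, so [u] is in the row space. [P] may be any set. *)
Lemma spanning_rows (K : fieldType) m (P : set 'rV[K]_m) :
  exists n (A : 'M[K]_(n, m)), (forall k, P (row k A)) /\
    forall u, P u -> (u <= A)%MS.
Proof.
pose Q r :=
  `[< exists n (A : 'M[K]_(n, m)), (forall k, P (row k A)) /\ \rank A = r >].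
have Q0 : exists r, Q r.
  by exists 0%N; apply/asboolP; exists 0%N, 0; rewrite mxrank0; split => // -[].
have Qm r : Q r -> (r <= m)%N.
  by move=> /asboolP[n [A [_ <-]]]; exact: rank_leq_col.
case: (ex_maxnP Q0 Qm) => r /asboolP[n [A [PA Ar]]] rmax.
exists n, A; split => // u Pu.
have : (\rank (col_mx A u) <= r)%N.
  apply: rmax; apply/asboolP; exists (n + 1)%N, (col_mx A u); split => // k.
  by case: (split_ordP k) => j ->; rewrite ?rowKu ?rowKd// row_id.
rewrite -Ar -addsmxE => rk; have := addsmxSl A u.
by move=> /mxrank_leqif_sup/geq_leqif; rewrite rk addsmx_sub => /esym/andP[].
Qed.

Lemma finite_dimensional_of_coords (R : realType) (E : lmodType R) m
    (phi : {linear E -> 'rV[R]_m}) :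
  injective phi -> ~ infinite_dimensional E.
Proof.
move=> inj_phi; apply; have [n [A [PA spanA]]] := spanning_rows (range phi).
have pb k : exists b, phi b = row k A by have [b _ bA] := PA k; exists b.
have [b bA] := choice pb.
exists n, b => x; have /submxP[D xD] : (phi x <= A)%MS.
  by apply: spanA; exists x.
exists (D 0); apply: inj_phi; rewrite xD linear_sum mulmx_sum_row.
by apply: eq_bigr => k _; rewrite linearZ /= bA.
Qed.

Lemma complete_sub_lcs_finite_support (R : realType) (X : topologicalType)
    (L : tvsType R) (i : X -> L) (V : submodClosed L) :
  tychonoff_space X -> free_lcs i ->
  @metrizable R (sub_lcs V) -> tvs_complete (sub_lcs V) ->
  exists s : seq X, uniq s /\
    forall w, w \in V -> exists c : X -> R, w = \sum_(x <- s) c x *: i x.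
Proof.
move=> tX freeL mV cV.
(* These are the vectors supported on fewer than [n] points. *)
pose F n := [set v : sub_lcs V | ~ disjoint_detected i n (val v)].
have [n [v0 v0n]] : exists n (v : sub_lcs V), nbhs v (F n).
  apply: tvs_baire => //.
    move=> n; rewrite -[F n]setCK; apply: open_closedC.
    have -> : ~` F n = val @^-1` [set y | disjoint_detected i n y].
      by apply/seteqP; split => v /=; rewrite /F /= notK.
    apply: open_comp; last exact: open_disjoint_detected.
    by move=> v _; exact: val_sub_lcs_continuous.
  move=> v; have [s [c sc]] := free_lcs_supported freeL (val v).
  exists (size s).+1 => /(detected_support_size sc).
  by rewrite ltnn.
have near_line (w : sub_lcs V) (U : set (sub_lcs V)) (v : sub_lcs V) : nbhs v U ->
    \forall t \near (0 : R)^', U (v + t *: w).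
  move=> Uv; apply: (@nbhs_dnbhs R^o).
  have cw : continuous (fun t : R^o => v + t *: w).
    move=> t; apply: (@continuous_comp R^o (sub_lcs V * sub_lcs V)%type _
      (fun t => (v, t *: w)) (fun z => z.1 + z.2)); last exact: add_continuous.
    apply: (cvg_pair (F := nbhs (t : R^o)) (G := nbhs v) (H := nbhs (t *: w))).
      exact: cvg_cst.
    apply: (@continuous_comp R^o (R^o * sub_lcs V)%type _
      (fun t => (t, w)) (fun z => z.1 *: z.2)); last exact: scale_continuous.
    by apply: (cvg_pair (F := nbhs (t : R^o)) (G := nbhs (t : R^o))
      (H := nbhs w)); [exact: cvg_id|exact: cvg_cst].
  by apply: (cw 0 U); rewrite /= scale0r addr0.
(* If [h j w != 0] for all [j], then also [h j (v0 + t w) != 0] for all small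
   [t != 0], so a bound on the supports near [v0] holds on all of [V]. *)
have Fn (w : sub_lcs V) : F n w.
  move=> [h [ch hdisj hw]].
  have : \forall t \near (0 : R)^', forall j, h j (val v0) + t * h j (val w) != 0.
    apply: (@filter_forall _ 'I_n (fun j t => h j (val v0) + t * h j (val w) != 0)).
    by move=> j; apply: near_affine_neq0; rewrite hw orbT.
  move=> /(filterI (near_line w _ _ v0n))/filter_ex[t [+ ht]]; apply.
  by exists h; split => // j; rewrite linearD linearZ.
pose P m :=
  `[< exists v : sub_lcs V, exists s c, supported i (val v) s c /\ size s = m >].
have P0 : exists m, P m.
  have [s [c sc]] := free_lcs_supported freeL (val (0 : sub_lcs V)).
  by exists (size s); apply/asboolP; exists 0, s, c.
have Pn m : P m -> (m <= n)%N.
  (* With a support of more than [n] points, the first [n] separating functionals would already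
     detect [v]. *)
  move=> /asboolP[v [s [c [sc <-]]]]; rewrite leqNgt; apply/negP => /ltnW ns.
  have [h [ch hdisj hv]] := supported_detected tX freeL sc.
  apply: (Fn v); exists (fun j => h (widen_ord ns j)); split.
  - by move=> j; exact: ch.
  - by move=> j k x hj hk; apply: val_inj; have /(congr1 val) := hdisj _ _ _ hj hk.
  - by move=> j; exact: hv.
(* For small [t != 0] no cancellation occurs in [v + t w], so by maximality the
   support [s] of [v] contains that of every [w]. *)
case: (ex_maxnP P0 Pn) => m /asboolP[v [s [c [sc sm]]]] mmax.
have [us sE vE] := sc.
exists s; split => // w wV.
have [s' [c' s'c']] := free_lcs_supported freeL w.
exists c'; apply: (supported_widen s'c' us) => x xs'.
apply: contraT => xs.
have [us' s'E wE] := s'c'.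
pose w' : sub_lcs V := exist _ w wV.
pose u := undup (s ++ s').
have uu : uniq u by exact: undup_uniq.
have : \forall t \near (0 : R)^', forall j : 'I_(size u),
    c (tnth (in_tuple u) j) + t * c' (tnth (in_tuple u) j) != 0.
  apply: (@filter_forall _ _ (fun (j : 'I_(size u)) t =>
    c (tnth (in_tuple u) j) + t * c' (tnth (in_tuple u) j) != 0)) => j.
  apply: near_affine_neq0; rewrite -sE -s'E -mem_cat -mem_undup.
  exact: mem_tnth.
move=> /filter_ex[t ct].
have : (size u <= m)%N.
  apply: mmax; apply/asboolP; exists (v + t *: w'), u, (fun z => c z + t * c' z).
  split => //; split => //.
  - move=> z; have [zu|] := boolP (z \in u).
      by have /tnthP[j ->] : z \in in_tuple u by []; rewrite ct.
    rewrite mem_undup mem_cat negb_or sE s'E !negbK => /andP[/eqP -> /eqP ->].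
    by rewrite mulr0 addr0 eqxx.
  - have su : {subset s <= u} by move=> z zs; rewrite mem_undup mem_cat zs.
    have s'u : {subset s' <= u} by move=> z zs; rewrite mem_undup mem_cat zs orbT.
    rewrite (_ : val (v + t *: w') = val v + t *: w)//.
    rewrite (supported_widen sc uu su) (supported_widen s'c' uu s'u).
    rewrite scaler_sumr -big_split /=; apply: eq_bigr => z _.
    by rewrite scalerDl scalerA.
(* The union [u] contains [s] and the extra point [x], so it has more than [m] points. *)
have : (size (x :: s) <= size u)%N.
  apply: uniq_leq_size; first by rewrite /= xs.
  move=> z; rewrite in_cons mem_undup mem_cat => /predU1P[->|->] //.
  by rewrite xs' orbT.
by rewrite /= sm => /leq_trans/[apply]; rewrite ltnn.
Qed.

(** The functionals separating the common support [s] serve as coordinates: they recover every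
    coefficient of a vector of [V], hence are jointly injective on [V]. *)
Lemma complete_sub_lcs_finite_dimensional (R : realType) (X : topologicalType)
    (L : tvsType R) (i : X -> L) (V : submodClosed L) :
  tychonoff_space X -> free_lcs i ->
  @metrizable R (sub_lcs V) -> tvs_complete (sub_lcs V) ->
  ~ infinite_dimensional (sub_lcs V).
Proof.
move=> tX freeL mV cV.
have [s [us sV]] := complete_sub_lcs_finite_support tX freeL mV cV.
have [h [ch hx hdisj]] := separating_functionals tX freeL s.
pose phi (w : sub_lcs V) : 'rV[R]_(size s) :=
  \row_j h (tnth (in_tuple s) j) (val w).
have lphi : linear phi.
  by move=> a u v; apply/rowP => j; rewrite !mxE /= linearD linearZ.
have [psi psiE] := linear_bundle lphi.
apply: (finite_dimensional_of_coords (phi := psi)).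
apply/raddf_inj => w psiw; have /rowP pw : phi w = 0 by rewrite psiE.
have [c wE] := sV _ (valP w).
apply: val_inj; rewrite /= wE big_seq big1// => x xs.
have /tnthP[j xj] : x \in in_tuple s by [].
have := pw j; rewrite !mxE -xj wE linear_sum /= (bigD1_seq x)//= linearZ /= hx.
rewrite big_seq_cond big1 ?addr0.
  by rewrite -[_ *: _]/(_ * _) mulr1 => ->; rewrite scale0r.
move=> z /andP[zs zx]; rewrite linearZ /=.
have [->|hz] := eqVneq (h x (i z)) 0; first by rewrite scaler0.
by move: zx; rewrite (hdisj x z z) ?eqxx// hx oner_neq0.
Qed.

(** * The dual of a finite-dimensional normed space *)

Section FiniteDimensionalDual.
Context (R : realType) (E : tvsType R).

Lemma is_norm0 (N : E -> R) : is_norm N -> N 0 = 0.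
Proof. by move=> [_ NZ _]; rewrite -[0](scale0r 0) NZ normr0 mul0r. Qed.

Lemma norm_metrizable (N : E -> R) :
  is_norm N -> norm_induces_topology N -> @metrizable R E.
Proof.
move=> normN topN; have [N0 NZ ND] := normN.
exists (fun x y => N (x - y)); split => //.
- move=> x y; split => [/N0/eqP|->]; first by rewrite subr_eq0 => /eqP.
  by rewrite subrr is_norm0.
- by move=> x y; rewrite -opprB -scaleN1r NZ normrN1 mul1r.
- by move=> x y z; rewrite -[x](subrK y) -addrA (le_trans (ND _ _))// subrK.
Qed.

Lemma continuous_dual_bounded (N : E -> R) (psi : E -> R^o) :
  is_norm N -> norm_induces_topology N -> @continuous_dual R E psi ->
  exists2 M, 0 <= M & forall x, N x <= 1 -> `|psi x| <= M.
Proof.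
move=> normN topN [lpsi cpsi]; have [_ NZ _] := normN.
have [psi' psiE] := linear_bundle lpsi; subst psi.
have /topN[e e0 eU] : nbhs (0 : E) [set y | `|psi' y| < 1].
  apply: (cpsi 0 [set z : R^o | `|z| < 1]); rewrite linear0.
  by have /cvgrPdist_lt/(_ 1 ltr01) := @cvg_id _ (nbhs (0 : R^o));
    apply: filterS => z /=; rewrite sub0r normrN.
(* Scaling by [e / 2] brings the closed unit ball inside the open ball of radius [e]. *)
exists (2 / e); first by rewrite divr_ge0// ltW.
move=> x Nx; have e20 : 0 < e / 2 by rewrite divr_gt0.
have : `|psi' ((e / 2) *: x)| < 1.
  apply: eU; rewrite /= sub0r -scaleN1r scalerA NZ mulN1r normrN gtr0_norm//.
  rewrite (@le_lt_trans _ _ (e / 2))//; first by rewrite ler_piMr// ltW.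
  by rewrite gtr_pMr// invf_lt1// ltr1n.
rewrite linearZ normrM gtr0_norm// -ltr_pdivlMl// mulr1 invf_div.
exact: ltW.
Qed.

Lemma continuous_dual_sum n (psi : 'I_n -> E -> R^o) (a : 'I_n -> R) :
  (forall j, @continuous_dual R E (psi j)) ->
  @continuous_dual R E (fun x => \sum_(j < n) a j * psi j x).
Proof.
move=> dpsi; split.
  move=> t u v; rewrite scaler_sumr -big_split /=; apply: eq_bigr => j _.
  have [lpsi _] := dpsi j.
  by rewrite lpsi mulrDr -[t *: psi j u]/(t * _) mulrCA.
apply: (continuous_big (@add_continuous R^o)) => j _ x.
by apply: cvgM; [exact: cvg_cst|have [_] := dpsi j; exact].
Qed.

(** A functional is determined by its values on the spanning family [b]. As [b] may be dependent and
    coordinates discontinuous, the generators are chosen among the continuous functionals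
    themselves, by [spanning_rows] on their value vectors. *)
Lemma continuous_dual_finite_span : ~ infinite_dimensional E ->
  exists n (psi : 'I_n -> E -> R^o), (forall j, @continuous_dual R E (psi j)) /\
    forall phi, @continuous_dual R E phi ->
      exists a : 'I_n -> R, forall x, phi x = \sum_(j < n) a j * psi j x.
Proof.
move=> /contrapT[m [b bE]].
pose ev (phi : E -> R^o) : 'rV[R]_m := \row_k phi (b k).
have [n [A [PA spanA]]] := spanning_rows (ev @` @continuous_dual R E).
have ex_psi j : exists psi, @continuous_dual R E psi /\ ev psi = row j A.
  by have [psi ? ?] := PA j; exists psi.
have [psi psiP] := choice ex_psi.
exists n, psi; split; first by move=> j; have [] := psiP j.
move=> phi dphi; have /submxP[D phiD] : (ev phi <= A)%MS.
  by apply: spanA; exists phi.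
exists (D 0).
have [lchi _] := continuous_dual_sum (D 0) (fun j => (psiP j).1).
set chi := fun x => \sum_(j < n) D 0 j * psi j x.
have phi_b k : phi (b k) = chi (b k).
  have /rowP/(_ k) := phiD; rewrite !mxE => ->; apply: eq_bigr => j _.
  by have [_ /rowP/(_ k)] := psiP j; rewrite !mxE => ->.
have [lphi _] := dphi => x; have [c ->] := bE x.
have [phi' phiE] := linear_bundle lphi; have [chi' chiE] := linear_bundle lchi.
have {}phiE y : phi y = phi' y by rewrite phiE.
have {}chiE y : chi y = chi' y by rewrite -chiE.
rewrite -[RHS]/(chi _) phiE chiE !linear_sum; apply: eq_bigr => k _.
by rewrite !linearZ /= -phiE -chiE phi_b.
Qed.

Lemma finite_dimensional_separable_dual (N : E -> R) :
  is_norm N -> norm_induces_topology N -> ~ infinite_dimensional E ->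
  separable_dual N.
Proof.
move=> normN topN /continuous_dual_finite_span[n [psi [dpsi spanpsi]]].
have ex_M j : exists M, 0 <= M /\ forall x, N x <= 1 -> `|psi j x| <= M.
  by have [M] := continuous_dual_bounded normN topN (dpsi j); exists M.
have [M MP] := choice ex_M.
pose comb (q : {ffun 'I_n -> rat}) (x : E) : R^o :=
  \sum_(j < n) ratr (q j) * psi j x.
exists (range comb); split.
- by apply: (sub_countable (card_image_le _ _)); exact: countableP.
- by move=> _ [q _ <-]; exact: continuous_dual_sum.
move=> phi /spanpsi[a aE] e e0.
pose S := \sum_(j < n) M j.
have S0 : 0 <= S by apply: sumr_ge0 => j _; case: (MP j).
(* An error [d] in each coefficient costs at most [d * S <= e / 2]; the [+ 1] covers [S = 0]. *)
pose d := e / 2 / (S + 1).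
have d0 : 0 < d by rewrite !divr_gt0// ltr_wpDl.
have [q qP] : exists q : {ffun 'I_n -> rat}, forall j, `|a j - ratr (q j)| <= d.
  have ex_q j : exists r : rat, `|a j - ratr r| <= d.
    have [|r] := @rat_in_itvoo _ (a j - d) (a j + d).
      by rewrite ltrBlDr -addrA ltrDl addr_gt0.
    rewrite in_itv /= => /andP[r1 r2]; exists r.
    by rewrite ltW// ltr_distlC r1.
  have [q qP] := choice ex_q.
  by exists [ffun j => q j] => j; rewrite ffunE.
exists (comb q); first by exists q.
apply: (@le_lt_trans _ _ (e / 2)); last by rewrite gtr_pMr// invf_lt1// ltr1n.
(* Bounding the supremum requires a nonempty set; 0 lies in the unit ball. *)
apply: ge_sup.
  by exists `|phi 0 - comb q 0|; exists 0 => //=; rewrite is_norm0.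
move=> _ [x /= Nx <-].
rewrite aE /comb -sumrB (le_trans (ler_norm_sum _ _ _))//.
apply: (@le_trans _ _ (\sum_(j < n) d * M j)).
  apply: ler_sum => j _; rewrite -mulrBl normrM ler_pM//.
  by have [_] := MP j; apply.
rewrite -mulr_sumr -/S /d mulrAC ler_pdivrMr ?ltr_wpDl//.
by rewrite ler_pM2l ?divr_gt0// lerDl.
Qed.

End FiniteDimensionalDual.

(** * A nowhere differentiable seminorm *)

(** An infinite open set [W] is repeatedly split into a nonempty open piece and a disjoint infinite
    open remainder. Take disjoint neighbourhoods [A], [B] of two points of [W]: if [B] meets [W] in
    a finite set, that set is the piece and, being closed, leaves an open remainder; otherwise [A]
    gives the piece and [B] the remainder. *)
Lemma infinite_disjoint_opens (T : topologicalType) :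
  hausdorff_space T -> infinite_set [set: T] ->
  exists U : nat -> set T,
    [/\ forall n, open (U n), forall n, U n !=set0 &
        forall m n x, U m x -> U n x -> m = n].
Proof.
move=> hT iT.
pose P (W : set T) := open W /\ infinite_set W.
have step (W : set T) : exists p : set T * set T, P W ->
    [/\ open p.1, p.1 !=set0, P p.2 & p.1 `<=` W /\ p.2 `<=` W `\` p.1].
  have [[oW iW]|nP] := pselect (P W); last by exists (set0, set0).
  have [x Wx] := infinite_setN0 iW.
  have iWx : infinite_set (W `\ x).
    by apply: infinite_setD => //; exact: finite_set1.
  have [y [Wy yx]] := infinite_setN0 iWx.
  have xy : x != y by apply/eqP => xy; exact: yx.
  move: (hT); rewrite open_hausdorff => /(_ _ _ xy).
  move=> [[A B] /= [/set_mem Ax /set_mem By]] [oA oB /eqP AB].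
  have oBW : open (B `&` W) by exact: openI.
  have [fB|iB] := pselect (finite_set (B `&` W)).
    exists (B `&` W, W `\` (B `&` W)) => _; split => //=.
    - by exists y.
    - split; last exact: infinite_setD.
      rewrite setDE; apply: openI => //; apply: closed_openC.
      have /accessible_finite_set_closed : accessible_space T.
        exact: hausdorff_accessible.
      exact.
    - by split=> // z [].
  exists (A `&` W, B `&` W) => _; split => //=.
  - exact: openI.
  - by exists x.
  - split => // z [Bz Wz]; split=> // -[Az _].
    by have : (A `&` B) z by []; rewrite AB.
have [g gP] := choice step.
pose W n := iter n (fun W => (g W).2) setT.
have PW n : P (W n).
  elim: n => [|n IH]; first by split => //; exact: openT.
  by have [] := gP _ IH.
have Wle m n : (m <= n)%N -> W n `<=` W m.
  elim: n => [|n IH]; first by rewrite leqn0 => /eqP ->.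
  rewrite leq_eqVlt => /predU1P[-> //|/IH sub] z zW; apply: sub.
  by have [_ _ _ [_ /(_ z zW)[]]] := gP _ (PW n).
exists (fun n => (g (W n)).1); split.
- by move=> n; have [] := gP _ (PW n).
- by move=> n; have [] := gP _ (PW n).
have lt_disj m n x : (m < n)%N -> (g (W m)).1 x -> (g (W n)).1 x -> False.
  move=> mn xm xn.
  have [_ _ _ [/(_ x xn) xW _]] := gP _ (PW n).
  have := Wle _ _ mn _ xW.
  by have [_ _ _ [_ /[apply]]] := gP _ (PW m) => -[].
move=> m n x xm xn; case: (ltngtP m n) => // mn.
  by case: (lt_disj m n x).
by case: (lt_disj n m x).
Qed.

(* Polynomials stand for finitely supported sequences. *)
Definition l1_poly (R : realType) : Type := {poly R}.

Section L1Poly.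
Context {R : realType}.

HB.instance Definition _ := GRing.Lmodule.copy (l1_poly R) {poly R}.

Definition l1_norm (p : l1_poly R) : R :=
  \sum_(k < size (p : {poly R})) `|(p : {poly R})`_k|.

Lemma l1_normE n (p : l1_poly R) : (size (p : {poly R}) <= n)%N ->
  l1_norm p = \sum_(k < n) `|(p : {poly R})`_k|.
Proof.
move=> pn; rewrite /l1_norm.
rewrite (big_ord_widen n (fun k => `|(p : {poly R})`_k|) pn) big_mkcond /=.
apply: eq_bigr => k _; case: ltnP => // pk.
by rewrite nth_default// normr0.
Qed.

Let l1_normD (p q : l1_poly R) : l1_norm (p + q) <= l1_norm p + l1_norm q.
Proof.
pose n := maxn (size (p : {poly R})) (size (q : {poly R})).
rewrite !(@l1_normE n) ?leq_maxl ?leq_maxr ?(leq_trans (size_polyD _ _))//.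
rewrite -big_split /=; apply: ler_sum => k _.
by rewrite coefD ler_normD.
Qed.

Let l1_normZ (a : R) (p : l1_poly R) : l1_norm (a *: p) = `|a| * l1_norm p.
Proof.
rewrite (@l1_normE (size (p : {poly R})) (a *: p)) ?size_scale_leq//.
by rewrite /l1_norm big_distrr /=; apply: eq_bigr => k _; rewrite coefZ normrM.
Qed.

Let l1_norm0_eq0 (p : l1_poly R) : l1_norm p = 0 -> p = 0.
Proof.
move=> /eqP; rewrite psumr_eq0 // => /allP p0.
apply/polyP => k; rewrite coef0.
have [pk|kp] := leqP (size (p : {poly R})) k; first by rewrite nth_default.
by have /(_ (mem_index_enum _)) := p0 (Ordinal kp); rewrite normr_eq0 => /eqP.
Qed.

HB.instance Definition _ := Lmodule_isNormed.Build R (l1_poly R)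
  l1_normD l1_normZ l1_norm0_eq0.

Lemma l1_norm_monomial (a : R) n : `| (a *: 'X^n : l1_poly R) | = `|a|.
Proof.
rewrite -[LHS]/(l1_norm _) l1_normZ (@l1_normE n.+1) ?size_polyXn//.
rewrite big_ord_recr /= big1 ?add0r ?coefXn ?eqxx ?normr1 ?mulr1// => k _.
by rewrite coefXn (ltn_eqF (ltn_ord k)) normr0.
Qed.

(** Coordinate [n] of [p] is zero, so nothing cancels. The term [|a|] is the kink that later
    excludes differentiability. *)
Lemma l1_normD_monomial (p : l1_poly R) (a : R) n : (size (p : {poly R}) <= n)%N ->
  `| p + a *: 'X^n : l1_poly R | = `|p| + `|a|.
Proof.
move=> pn; rewrite -[LHS]/(l1_norm _) -[X in _ = X + _]/(l1_norm p) (l1_normE pn).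
rewrite (@l1_normE n.+1); last first.
  rewrite (leq_trans (size_polyD _ _))// geq_max (leq_trans pn)//=.
  by rewrite (leq_trans (size_scale_leq _ _))// size_polyXn.
rewrite big_ord_recr /= coefD coefZ coefXn eqxx mulr1 nth_default// add0r.
congr (_ + _); apply: eq_bigr => k _.
by rewrite coefD coefZ coefXn (ltn_eqF (ltn_ord k)) mulr0 addr0.
Qed.

End L1Poly.

(** Where some [f n] is nonzero, [F] is locally one continuous multiple of ['X^n]. At a common zero
    the supports may accumulate: indices [n >= m] are controlled by [c n < e], the finitely many
    others by continuity of [f n]. *)
Lemma continuous_disjoint_bumps (R : realType) (X : topologicalType)
    (f : nat -> X -> R^o) (c : nat -> R) (F : X -> l1_poly R) :
  (forall n, continuous (f n)) -> (forall n x, 0 <= f n x <= 1) ->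
  (forall m n x, f m x != 0 -> f n x != 0 -> m = n) ->
  (forall n, 0 <= c n) -> c n @[n --> \oo] --> (0 : R) ->
  (forall n x, f n x != 0 -> F x = c n * f n x *: 'X^n) ->
  (forall x, (forall n, f n x = 0) -> F x = 0) ->
  continuous F.
Proof.
move=> cf f01 fdisj c0 cc FE F0 x.
apply/cvgrPdist_lt => e e0.
have [[n fnx]|nf] := pselect (exists n, f n x != 0).
  rewrite (FE _ _ fnx).
  have near_fn : \forall y \near x, f n y != 0.
    have : nbhs (f n x) [set y | y != 0].
      by apply: open_nbhs_nbhs; split => //; exact: open_neq.
    exact: cf.
  have near_d : \forall y \near x, `|f n x * c n - f n y * c n| < e.
    have : (f n y * c n) @[y --> x] --> f n x * c n.
      by apply: cvgM; [exact: cf|exact: cvg_cst].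
    by move=> /cvgrPdist_lt; apply.
  near=> y.
  rewrite (FE n y); last by near: y.
  rewrite -scalerBl l1_norm_monomial ![c n * _]mulrC.
  by near: y.
have fx n : f n x = 0 by apply/eqP/negPn/negP => fn; apply: nf; exists n.
rewrite (F0 x)//.
have /cvgrPdist_lt/(_ _ e0)[m _ cm] := cc.
have near_f k : \forall y \near x, f k y * c k < e.
  have : (f k y * c k) @[y --> x] --> f k x * c k.
    by apply: cvgM; [exact: cf|exact: cvg_cst].
  move=> /cvgrPdist_lt/(_ _ e0).
  apply: filterS => y; rewrite fx mul0r sub0r normrN.
  by apply: le_lt_trans; exact: ler_norm.
have : \forall y \near x, forall k : 'I_m, f k y * c k < e.
  by apply: (@filter_forall _ 'I_m (fun k y => f k y * c k < e)) => k; exact: near_f.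
apply: filterS => y fy; rewrite sub0r normrN.
have [[n fny]|nf'] := pselect (exists n, f n y != 0); last first.
  by rewrite F0 ?normr0// => n; apply/eqP/negPn/negP => fn; apply: nf'; exists n.
have /andP[fy0 fy1] := f01 n y.
rewrite (FE n y)// l1_norm_monomial ger0_norm ?mulr_ge0//.
have [nm|mn] := ltnP n m; first by rewrite mulrC; exact: (fy (Ordinal nm)).
apply: le_lt_trans (_ : c n < e); first by rewrite ler_piMr.
by have := cm n mn; rewrite /= sub0r normrN ger0_norm.
Unshelve. all: by end_near.
Qed.

Lemma free_lcs_not_gds (R : realType) (X : topologicalType) (L : tvsType R)
    (i : X -> L) :
  tychonoff_space X -> free_lcs i -> infinite_set [set: X] ->
  ~ gateaux_differentiability_space L.
Proof.
move=> [crX hX] [hL ci freeL] iX gdsL.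
have [U [oU U0 disjU]] := infinite_disjoint_opens hX iX.
have [x Ux] := choice U0.
have bump n : exists f : X -> R^o, [/\ continuous f, f (x n) = 1,
    forall y, 0 <= f y <= 1 & forall y, ~ U n y -> f y = 0].
  exact: completely_regular_bump.
have [f fP] := choice bump.
have fU n y : f n y != 0 -> U n y.
  have [_ _ _ fU] := fP n.
  by move=> fny; apply: contrapT => /fU/eqP; exact/negP.
have fdisj m n y : f m y != 0 -> f n y != 0 -> m = n.
  by move=> /fU + /fU; exact: disjU.
have FP y : exists p : l1_poly R,
    (forall n, f n y != 0 -> p = harmonic n * f n y *: 'X^n) /\
    ((forall n, f n y = 0) -> p = 0).
  have [[n fny]|nf] := pselect (exists n, f n y != 0).
    exists (harmonic n * f n y *: 'X^n); split.
      by move=> m fmy; rewrite (fdisj _ _ _ fny fmy).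
    by move=> f0; rewrite f0 eqxx in fny.
  by exists 0; split => // n fny; exfalso; apply: nf; exists n.
have [F FE] := choice FP.
have cF : continuous F.
  apply: (@continuous_disjoint_bumps _ _ f harmonic) => //.
  - by move=> n; have [] := fP n.
  - by move=> n; have [] := fP n.
  - by move=> n; rewrite harmonic_ge0.
  - exact: cvg_harmonic.
  - by move=> n y; apply: (FE y).1.
  - by move=> y; apply: (FE y).2.
(* The universal property covers every Hausdorff target, so the incomplete space of polynomials is
   allowed; it makes each [h z] finitely supported. *)
have [g [[lg cg Fg] _]] := freeL (l1_poly R) (@norm_hausdorff R (l1_poly R)) F cF.
have [h gh] := linear_bundle lg; subst g.
pose p (y : L) : R^o := `|h y|.
have gD (a : R) u v : h (u + a *: v) = h u + a *: h v by rewrite linearD linearZ.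
have gxn n : h (i (x n)) = harmonic n *: 'X^n.
  have fx1 : f n (x n) = 1 by have [] := fP n.
  have := (FE (x n)).1 n; rewrite fx1 mulr1 oner_neq0 => <- //.
  by rewrite Fg.
(* With [D] all of [L], a single point [z] of differentiability gives the contradiction. *)
have /(_ 0 I) : setT `<=` closure (setT `&` [set y : L | gateaux_differentiable p y]).
  apply: gdsL.
  - by exists 0.
  - exact: openT.
  - by move=> u v t _ _; rewrite in_setT.
  - apply: continuous_subspaceT => y.
    by apply: continuous_comp; [exact: cg|exact: norm_continuous].
  - move=> t u v _ _.
    have -> : conv t u v = t%:num *: u + (1 - t%:num) *: v :> L by [].
    rewrite -[leRHS]/(t%:num * p u + (1 - t%:num) * p v) /p gD linearZ.
    rewrite (le_trans (ler_normD _ _))// !normrZ.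
    by rewrite !ger0_norm// subr_ge0.
move=> /(_ setT filterT)[z [[_ [phi _ dphi]] _]].
pose n := size (h z : {poly R}).
pose c : R := harmonic n.
have c0 : 0 < c by rewrite harmonic_gt0.
(* Beyond its degree [n] the polynomial [h z] is perturbed in a fresh coordinate,
   so the difference quotient is [c * sgn t]. *)
have := dphi (i (x n)).
have -> : (fun t => (p (z + t *: i (x n)) - p z) / t) = (fun t : R => `|t| * c / t).
  apply/funext => t.
  by rewrite /p gD gxn scalerA l1_normD_monomial// addrC addKr normrM (gtr0_norm c0).
(* The quotient is [c] at [d / 2] and [- c] at [- (d / 2)]; being within [c] of both, [l] would be
   positive and negative. *)
move: (phi _) => l /cvgrPdist_lt/(_ _ c0)[d /= d0 dl].
have := dl (d / 2); have := dl (- (d / 2)).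
rewrite /= sub0r sub0r !opprK normrN gtr0_norm ?divr_gt0// oppr_eq0.
have d20 : d / 2 != 0 by rewrite gt_eqF// divr_gt0.
have dd : d / 2 < d by rewrite gtr_pMr// invf_lt1// ltr1n.
move=> /(_ dd d20) h1 /(_ dd d20).
rewrite invrN mulrN opprK in h1.
rewrite mulrAC mulfV// mul1r in h1 *.
move: h1; rewrite !ltr_norml => /andP[_]; rewrite gtrDr => l0 /andP[+ _].
by rewrite ltrBrDr addNr => /lt_trans/(_ l0); rewrite ltxx.
Qed.

Theorem corollary5p3 (R : realType) (X : topologicalType)
    (tychonoffX : tychonoff_space X)
    (L : tvsType R) (i : X -> L) (freeL : free_lcs i) :
  [/\ forall V : submodClosed L,
        infinite_dimensional (sub_lcs V) -> ~ frechet (sub_lcs V),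
      forall (V : submodClosed L) (N : sub_lcs V -> R),
        banach_norm N -> separable_dual N &
      infinite_set [set: X] -> ~ gateaux_differentiability_space L].
Proof.
split.
- move=> V infV [_ mV cV].
  exact: (complete_sub_lcs_finite_dimensional tychonoffX freeL mV cV infV).
- move=> V N [normN topN cV]; apply: finite_dimensional_separable_dual => //.
  apply: (complete_sub_lcs_finite_dimensional tychonoffX freeL) => //.
  exact: norm_metrizable normN topN.
- exact: free_lcs_not_gds tychonoffX freeL.
Qed.
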